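(* Let $\mathbb{F}_q$ be a finite field, $q=p^r$ a prime power, and let $n$ be a positive integer such that $\gcd(n,q-1)=1$. Then all constacyclic codes of length $n$ over $\mathbb{F}_q$ (that is, all $\lambda$-constacyclic codes, for every $\lambda\in\mathbb{F}_q^*$) are equivalent to cyclic codes of length $n$ over $\mathbb{F}_q$.
   Context: A linear code of length $n$ over $\mathbb{F}_q$ is a subspace of $\mathbb{F}_q^n$. For $\lambda\in\mathbb{F}_q^*$, a linear code $C\subseteq\mathbb{F}_q^n$ is $\lambda$-constacyclic if $(\lambda c_{n-1},c_0,\ldots,c_{n-2})\in C$ whenever $(c_0,\ldots,c_{n-1})\in C$. Cyclic means $1$-constacyclic. Two codes of length $n$ are equivalent if one is mapped onto the other by a monomial transformation of $\mathbb{F}_q^n$, i.e. a permutation of coordinates composed with multiplication of each coordinate by a nonzero scalar. *)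

(* Defs.v *)
From HB Require Import structures.
From mathcomp Require Import all_boot all_order all_algebra all_fingroup.
Set Implicit Arguments.
Unset Strict Implicit.
Unset Printing Implicit Defensive.
Import GRing.Theory.
Local Open Scope ring_scope.

Definition linear_code (F : finFieldType) (n : nat) := {vspace 'rV[F]_n}.

(* (c_0, ..., c_(n-1)) |-> (lambda c_(n-1), c_0, ..., c_(n-2));
   ord_pred is cyclic, so it sends coordinate 0 to n-1. *)
Definition constashift (F : finFieldType) (n : nat) (lambda : F)
    (c : 'rV[F]_n) : 'rV[F]_n :=
  \row_(i < n) (if i == 0%N :> nat then lambda * c 0 (ord_pred i)
                else c 0 (ord_pred i)).

Definition constacyclic (F : finFieldType) (n : nat) (lambda : F)
    (C : linear_code F n) : Prop :=
  forall c : 'rV[F]_n, c \in C -> constashift lambda c \in C.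

Definition cyclic_code (F : finFieldType) (n : nat) (C : linear_code F n)
    : Prop := constacyclic 1 C.

Definition monomial_map (F : finFieldType) (n : nat) (s : 'S_n)
    (a : 'I_n -> F) (c : 'rV[F]_n) : 'rV[F]_n :=
  \row_(i < n) (a i * c 0 (s i)).

Definition code_equiv (F : finFieldType) (n : nat) (C D : linear_code F n)
    : Prop :=
  exists (s : 'S_n) (a : 'I_n -> F),
    (forall i : 'I_n, a i != 0) /\
    [set monomial_map s a c | c in C] = [set d in D].

(* Main.v *)
Require Import Defs.
From HB Require Import structures.
From mathcomp Require Import all_boot all_order all_algebra all_fingroup.
From mathcomp Require Import finfield.
Set Implicit Arguments.
Unset Strict Implicit.
Unset Printing Implicit Defensive.
Import GRing.Theory.
Local Open Scope ring_scope.

(* Since n is invertible modulo q - 1, the scalar lambda is an n-th power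
   delta ^ n.  The diagonal map c_i |-> delta ^ i c_i intertwines, up to the
   scalar delta, the lambda-constacyclic shift with the cyclic shift, hence it
   sends lambda-constacyclic codes to cyclic codes. *)

(** Bézout gives [u * n = v * #|F|.-1 + 1], and [x ^+ #|F|.-1 = 1] for nonzero [x], so [x ^+ u] is
    an [n]-th root of [x]. *)
Lemma finField_exp_coprime_surj (F : finFieldType) (n : nat) (x : F) :
  (0 < n)%N -> coprime n #|F|.-1 -> x != 0 -> exists y : F, y ^+ n = x.
Proof.
move=> n_gt0 /eqP co_n x_neq0.
have xU : x ^+ #|F|.-1 = 1.
  apply: (mulfI x_neq0).
  by rewrite -exprS prednK ?expf_card ?mulr1 // (cardD1 x).
have [u v def_u _] := egcdnP #|F|.-1 n_gt0.
exists (x ^+ u).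
by rewrite -exprM def_u co_n addn1 exprS mulnC exprM xU expr1n mulr1.
Qed.

Definition powers_row (F : finFieldType) (n : nat) (delta : F) : 'rV[F]_n :=
  \row_(i < n) delta ^+ i.

Lemma constashift_powers_row (F : finFieldType) (n : nat) (delta : F)
    (c : 'rV[F]_n) : delta != 0 ->
  constashift 1 (c *m diag_mx (powers_row n delta)) =
  delta^-1 *: (constashift (delta ^+ n) c *m diag_mx (powers_row n delta)).
Proof.
move=> delta_neq0; rewrite !mul_mx_diag; apply/rowP=> i; rewrite !mxE /=.
have n_gt0 : (0 < n)%N by apply: leq_ltn_trans (ltn_ord i).
(* Wrap-around coordinate: the entry arriving from position [n.-1] carries the weight
   [delta ^+ n.-1], which is [delta^-1 * delta ^+ n]. *)
have [i0 | i_neq0] := eqVneq (i : nat) 0%N.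
  rewrite i0 add0n expr0 mulr1 mul1r modn_small ?prednK //.
  by rewrite mulrA -[in delta ^+ n](prednK n_gt0) exprS mulKf // mulrC.
have i_gt0 : (0 < i)%N by rewrite lt0n.
(* This is the value of [ord_pred i]; away from 0 nothing wraps, and the weight [delta ^+ i.-1] is
   one power short of [delta ^+ i]. *)
have -> : ((i + n).-1 %% n = i.-1)%N.
  rewrite -{1}(prednK i_gt0) addSn /= modnDr modn_small //.
  exact: leq_ltn_trans (leq_pred _) (ltn_ord i).
by rewrite -[in delta ^+ i](prednK i_gt0) exprS mulrCA mulKf.
Qed.

Theorem theorem3p4 (p r q : nat) (F : finFieldType) (n : nat)
    (p_prime : prime p) (r_gt0 : (0 < r)%N) (q_def : q = (p ^ r)%N)
    (cardF : #|F| = q) (n_gt0 : (0 < n)%N) (n_coprime : gcdn n (q - 1) = 1%N) :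
  forall (lambda : F), lambda != 0 ->
  forall C : linear_code F n, constacyclic lambda C ->
  exists D : linear_code F n, cyclic_code D /\ code_equiv C D.
Proof.
move=> lambda lambda_neq0 C shiftC.
have [delta def_lambda] : exists delta : F, delta ^+ n = lambda.
  apply: finField_exp_coprime_surj => //.
  by rewrite /coprime cardF -subn1 n_coprime.
have delta_neq0 : delta != 0.
  by move: lambda_neq0; rewrite -def_lambda expf_eq0 n_gt0.
pose f := linfun (mulmxr (diag_mx (powers_row n delta)) : 'rV[F]_n -> 'rV[F]_n).
exists (f @: C)%VS; split.
  (* The extra factor [delta^-1] is harmless because [f @: C] is a subspace. *)
  move=> _ /memv_imgP[c Cc ->]; rewrite lfunE /= constashift_powers_row //.
  apply: rpredZ; apply/memv_imgP; exists (constashift lambda c).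
    exact: shiftC.
  by rewrite lfunE /= def_lambda.
(* The map [f] is monomial: it only rescales coordinates, so the permutation is the identity. *)
exists 1%g, (fun i : 'I_n => delta ^+ i); split=> [i|].
  exact: expf_neq0.
have fE c : monomial_map 1 (fun i : 'I_n => delta ^+ i) c = f c.
  by apply/rowP=> i; rewrite lfunE /= mul_mx_diag !mxE perm1 mulrC.
apply/setP=> d; rewrite inE; apply/imsetP/memv_imgP=> -[c Cc ->];
  by exists c; rewrite ?fE.
Qed.
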